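(* Let $F:\mathbb{R}^2\to\mathbb{R}^2$ be a polynomial map such that $F(0)=0$ and, for all $(x,y)\in\mathbb{R}^2$, all the (complex) eigenvalues of the Jacobian matrix $JF(x,y)$ have modulus smaller than one. Then there exist a real $2\times 2$ matrix $B$, real numbers $\alpha,\beta,a,b\in\mathbb{R}$ and a real polynomial $p$ in one variable such that, for all $(x,y)\in\mathbb{R}^2$, writing $u=ax+by$, $$F(x,y)=B\begin{pmatrix}x\\ y\end{pmatrix}+u^2p(u)\begin{pmatrix}\alpha\\ \beta\end{pmatrix}.$$
   Context: $JF(x,y)$ denotes the Jacobian matrix of $F$ at $(x,y)$. A polynomial map $\mathbb{R}^2\to\mathbb{R}^2$ is a map whose two coordinate functions are real polynomials in $(x,y)$. *)

(* Defs.v *)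
From HB Require Import structures.
From mathcomp Require Import all_boot all_order all_algebra.
From mathcomp Require Import complex.
From mathcomp Require Import reals topology normedtype derive.

Set Implicit Arguments.
Unset Strict Implicit.
Unset Printing Implicit Defensive.

Import GRing.Theory Num.Theory.
Import numFieldNormedType.Exports.

Local Open Scope ring_scope.

Definition vec2 (R : realType) (x y : R) : 'cV[R]_2 := \col_(i < 2) [:: x; y]`_i.

(* [{poly {poly R}}] is R[x][y]: the outer indeterminate is y and the
   coefficients are polynomials in x. *)
Definition polynomial_map (R : realType) (F : 'cV[R]_2 -> 'cV[R]_2) : Prop :=
  forall i : 'I_2, exists P : {poly {poly R}},
    forall x y : R, F (vec2 x y) i 0 = P.[y%:P].[x].

(* Row i is the gradient of the i-th coordinate, acting on column vectors; the
   library's [jacobian] acts on row vectors, so it is the transpose of this. *)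
Definition jacobian_mx (R : realType) (F : 'cV[R]_2 -> 'cV[R]_2)
    (v : 'cV[R]_2) : 'M[R]_2 :=
  \matrix_(i < 2, j < 2) 'D_(delta_mx j 0) (fun w : 'cV[R]_2 => F w i 0) v.

Definition complex_eigenvalue (R : realType) (A : 'M[R]_2) (z : R[i]) : bool :=
  eigenvalue (map_mx (real_complex R) A) z.

(* Main.v *)
(* The trace and the determinant of JF are bounded polynomials, hence constants
   t and d, so F = (t/2) id + (u_y, -u_x) for a polynomial u whose Hessian
   determinant is the constant d - t^2/4.  It remains to see that such a u is a
   quadratic polynomial plus a polynomial in one linear form.  If u has degree
   m >= 2 in y, comparing coefficients in the Hessian shows that y^m has a
   constant coefficient and that u has total degree at most m.  For m >= 3, a
   shear y -> y + l x makes the coefficient of y^(m-1) constant, and the same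
   comparison with weight 2 on x then gives 2 deg_x u <= m.  If deg_x u were at
   least 2, exchanging x and y in the total degree bound would give
   m <= deg_x u, a contradiction; so u has degree at most 1 in x. *)
Require Import Defs.
From HB Require Import structures.
From mathcomp Require Import all_boot all_order all_algebra.
From mathcomp Require Import complex.
From mathcomp Require polyrcf.
From mathcomp Require Import boolp reals topology normedtype derive.
From mathcomp Require Import zify ring lra.

Set Implicit Arguments.
Unset Strict Implicit.
Unset Printing Implicit Defensive.

Import Order.TTheory GRing.Theory Num.Theory.
Import numFieldNormedType.Exports.

Local Open Scope ring_scope.

(** * Partial derivatives and the Hessian determinant in R[x][y] *)

(* The outer indeterminate of [{poly {poly R}}] is y: [deriv] is d/dy, and d/dx
   is obtained by conjugating with [swapXY]. *)
Definition dx (R : comNzRingType) (u : {poly {poly R}}) : {poly {poly R}} :=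
  swapXY (swapXY u)^`().

Definition hessian (R : comNzRingType) (u : {poly {poly R}}) : {poly {poly R}} :=
  dx (dx u) * u^`()^`() - dx u^`() ^+ 2.

Section PartialDerivatives.
Variable R : comNzRingType.
Implicit Types u v : {poly {poly R}}.

Lemma coef_dx u i j : (dx u)`_j`_i = u`_j`_i.+1 *+ i.+1.
Proof. by rewrite coef_swapXY coef_deriv coefMn coef_swapXY. Qed.

Lemma dxD u v : dx (u + v) = dx u + dx v.
Proof. by rewrite /dx !rmorphD /= derivD rmorphD. Qed.

Lemma dxM u v : dx (u * v) = dx u * v + u * dx v.
Proof. by rewrite /dx rmorphM /= derivM rmorphD !rmorphM /= !swapXYK. Qed.

Lemma dxC (p : {poly R}) : dx p%:P = p^`()%:P.
Proof. by rewrite /dx swapXY_polyC deriv_map swapXY_map_polyC. Qed.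

Lemma dx0 : dx 0 = 0 :> {poly {poly R}}.
Proof. by rewrite -polyC0 dxC deriv0. Qed.

Lemma dxX : dx 'X = 0 :> {poly {poly R}}.
Proof. by rewrite /dx swapXY_X derivC raddf0. Qed.

Lemma dxN u : dx (- u) = - dx u.
Proof. by apply: (addIr (dx u)); rewrite -dxD !addNr dx0. Qed.

Lemma deriv_dx u : (dx u)^`() = dx u^`().
Proof.
by apply/polyP=> j; apply/polyP=> i; rewrite coef_dx !coef_deriv !coefMn coef_dx mulrnAC.
Qed.

Lemma dx_swapXY u : dx (swapXY u) = swapXY u^`().
Proof. by rewrite /dx swapXYK. Qed.

Lemma deriv_swapXY u : (swapXY u)^`() = swapXY (dx u).
Proof. by rewrite /dx swapXYK. Qed.

Lemma swapXYB u v : swapXY (u - v) = swapXY u - swapXY v.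
Proof. exact: raddfB. Qed.

Lemma swapXYM u v : swapXY (u * v) = swapXY u * swapXY v.
Proof. exact: rmorphM. Qed.

Lemma hessian_swapXY u : hessian (swapXY u) = swapXY (hessian u).
Proof.
have Exx : dx (dx (swapXY u)) = swapXY u^`()^`() by rewrite !dx_swapXY.
have Eyy : (swapXY u)^`()^`() = swapXY (dx (dx u)) by rewrite !deriv_swapXY.
have Exy : dx (swapXY u)^`() = swapXY (dx u^`()).
  by rewrite deriv_swapXY dx_swapXY deriv_dx.
rewrite /hessian Exx Eyy Exy mulrC; apply/esym.
by rewrite swapXYB swapXYM expr2 swapXYM -expr2.
Qed.

End PartialDerivatives.

(** * Shears y -> y + l x *)

Section Shear.
Variable R : comNzRingType.
Implicit Types u : {poly {poly R}}.

Definition shear (l : R) u := u \Po ('X + (l *: 'X)%:P).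

Lemma deriv_shear l u : (shear l u)^`() = shear l u^`().
Proof. by rewrite /shear deriv_comp derivD derivX derivC addr0 mulr1. Qed.

Lemma dx_shear l u : dx (shear l u) = shear l (dx u) + l%:P%:P * shear l u^`().
Proof.
rewrite /shear; elim/poly_ind: u => [|u p IH].
  by rewrite comp_poly0 deriv0 !dx0 comp_poly0 mulr0 addr0.
rewrite dxD dxM dxC dxX mulr0 addr0 !derivD !derivM derivX derivC addr0 mulr1.
rewrite !comp_polyD !comp_polyM comp_polyX !comp_polyC !dxD dxM IH dxC.
by rewrite dxD dxX dxC derivZ derivX add0r -[l *: 1]mul_polyC mulr1; ring.
Qed.

(** A shear is linear of determinant 1, so the Hessian matrix changes by a congruence that preserves
    its determinant. *)
Lemma hessian_shear l u : hessian (shear l u) = shear l (hessian u).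
Proof.
rewrite /hessian.
rewrite !(deriv_shear, dx_shear, dxD, dxM, dxC, derivC, mul0r, add0r, deriv_dx).
rewrite /shear comp_polyB expr2 !comp_polyM.
move: (_ \Po _) (dx u^`() \Po _) (u^`()^`() \Po _) => a b c; ring.
Qed.

Lemma coef_shear l u j :
  (shear l u)`_j = \sum_(i < size u) u`_i * ((l *: 'X) ^+ (i - j) *+ 'C(i, j)).
Proof.
rewrite coef_comp_poly; apply: eq_bigr => i _; congr (_ * _).
rewrite addrC exprDn coef_sum.
have E (k : nat) : ((l *: 'X)%:P ^+ (i - k) * 'X ^+ k *+ 'C(i, k))`_j =
         (l *: 'X) ^+ (i - j) *+ 'C(i, j) *+ (j == k).
  rewrite -rmorphXn /= coefMn coefCM coefXn.
  by case: eqP => [->|_]; rewrite ?mulr1 // mulr0 mul0rn.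
under eq_bigr => k _ do rewrite E.
have [ji|ij] := leqP j i.
  rewrite (bigD1 (Ordinal (ji : (j < i.+1)%N))) //= eqxx big1 ?addr0 // => k /eqP nk.
  by rewrite -[j == k]/(j == k :> nat); case: eqP => // e; case: nk; apply/val_inj.
by rewrite big1 ?bin_small ?mulr0n // => k _; rewrite mul0rn.
Qed.

Lemma horner_shear l u x y : (shear l u).[y%:P].[x] = u.[(y + l * x)%:P].[x].
Proof.
rewrite /shear horner_comp !hornerE.
have E (p q : {poly R}) : p.[x] = q.[x] -> u.[p].[x] = u.[q].[x].
  move=> pq; elim/poly_ind: u => [|v r IH]; first by rewrite !horner0.
  by rewrite !hornerE IH pq.
by apply: E; rewrite !hornerE.
Qed.

End Shear.

(** * Monomials of a polynomial with constant Hessian determinant *)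

(* Contribution of the monomials [x^i y^j] and [x^k y^l] of [u] to the
   coefficient of [x^(i+k) y^(j+l)] in [x^2 y^2 * hessian u]. *)
Definition hessian_kernel (R : nzRingType) (i j k l : nat) : R :=
  (i%:R ^+ 2 - i%:R) * (l%:R ^+ 2 - l%:R) - (i%:R * j%:R) * (k%:R * l%:R).

Section ConstantHessian.
Variable R : numDomainType.
Implicit Types u : {poly {poly R}}.

(** Multiplied by x^2 y^2, the Hessian becomes c x^2 y^2, whose coefficients vanish away from
    exponent (2, 2). *)
Lemma hessian_coef_sum u (c : R) (a b : nat) :
    hessian u = c%:P%:P -> (a, b) != (2, 2)%N ->
  \sum_(j < b.+1) \sum_(i < a.+1)
     hessian_kernel R i j (a - i) (b - j) * u`_j`_i * u`_(b - j)`_(a - i) = 0.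
Proof.
move=> uc ab.
(* Euler operators: they multiply coefficients without shifting indices. *)
pose ex (v : {poly {poly R}}) := 'X%:P * dx v.
pose ey (v : {poly {poly R}}) := v^`() * 'X.
have cx v i j : (ex v)`_j`_i = i%:R * v`_j`_i.
  rewrite /ex coefCM coefXM; case: i => [|i] /=; first by rewrite mul0r.
  by rewrite coef_dx mulr_natl.
have cy v i j : (ey v)`_j`_i = j%:R * v`_j`_i.
  rewrite /ey coefMX; case: j => [|j] /=; first by rewrite coef0 mul0r.
  by rewrite coef_deriv coefMn mulr_natl.
have E : (ex (ex u) - ex u) * (ey (ey u) - ey u) - ex (ey u) * ex (ey u) =
    (c *: 'X^2)%:P * 'X^2.
  rewrite -mul_polyC rmorphM /= -uc /hessian /ex /ey.
  rewrite !(dxM, dxC, dxX, derivM, derivC, derivX).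
  by rewrite rmorphXn /=; ring.
clearbody ex ey; have := congr1 (fun p : {poly {poly R}} => p`_b`_a) E.
have -> : ((c *: 'X^2)%:P * 'X^2 : {poly {poly R}})`_b`_a = 0.
  rewrite coefCM coefXn; move: ab; rewrite xpair_eqE negb_and.
  case: (b == 2%N); last by rewrite mulr0 coef0.
  by rewrite orbF mulr1 coefZ coefXn => /negPf ->; rewrite mulr0.
move=> /= E0; apply: etrans E0; rewrite coefB !coefM -sumrB coef_sum.
apply: eq_bigr => j _.
rewrite coefB !coefM -sumrB; apply: eq_bigr => i _.
rewrite !(coefB, cx, cy) /hessian_kernel; ring.
Qed.

(* If only one ordered pair of monomials contributes to a coefficient of the
   Hessian that has to vanish, then this contribution vanishes. *)
Lemma hessian_isolated_pair u (c : R) (i0 j0 i1 j1 : nat) :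
    hessian u = c%:P%:P -> (i0 + i1, j0 + j1)%N != (2, 2)%N ->
    (forall i j k l, (i + k = i0 + i1)%N -> (j + l = j0 + j1)%N ->
       (i, j) != (i0, j0) -> u`_j`_i != 0 -> u`_l`_k != 0 ->
       hessian_kernel R i j k l = 0) ->
  u`_j0`_i0 != 0 -> u`_j1`_i1 != 0 -> hessian_kernel R i0 j0 i1 j1 = 0.
Proof.
move=> uc ab iso u0 u1; have := hessian_coef_sum uc ab.
have lj : (j0 < (j0 + j1).+1)%N by lia.
have li : (i0 < (i0 + i1).+1)%N by lia.
have Z i j : (i <= i0 + i1)%N -> (j <= j0 + j1)%N -> (i, j) != (i0, j0) ->
   hessian_kernel R i j (i0 + i1 - i) (j0 + j1 - j) * u`_j`_i
     * u`_(j0 + j1 - j)`_(i0 + i1 - i) = 0.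
  move=> ii jj ne; have [->|n1] := eqVneq (u`_j`_i) 0; first by rewrite mulr0 mul0r.
  have [->|n2] := eqVneq (u`_(j0 + j1 - j)`_(i0 + i1 - i)) 0; first by rewrite mulr0.
  by rewrite (iso i j) ?mul0r //; lia.
rewrite (bigD1 (Ordinal lj)) //= [X in _ + X]big1 ?addr0; last first.
  move=> j nj; apply: big1 => i _; apply: Z; [by rewrite -ltnS|by rewrite -ltnS|].
  by rewrite xpair_eqE negb_and -(inj_eq val_inj) in nj *; rewrite nj orbT.
rewrite (bigD1 (Ordinal li)) //= [X in _ + X]big1 ?addr0; last first.
  move=> i ni; apply: Z; [by rewrite -ltnS|by []|].
  by rewrite xpair_eqE negb_and -(inj_eq val_inj) in ni *; rewrite ni.
rewrite !addKn => /eqP; rewrite !mulf_eq0 (negPf u0) (negPf u1) !orbF.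
by move/eqP.
Qed.

(** If the coefficient of y^m has degree d in x, then x^d y^m paired with itself is isolated and
    contributes - d m (d + m - 1). For d = m = 1 the exponent is the excluded (2, 2), hence the
    weaker bound when m = 1. *)
Lemma hessian_top_coef u (c : R) m :
    hessian u = c%:P%:P -> (0 < m)%N -> (size u <= m.+1)%N ->
  (size (u`_m)%R <= (m == 1%N).+1)%N.
Proof.
move=> uc m0 um; rewrite leqNgt; apply/negP => su.
pose d := (size u`_m).-1.
have sd : size u`_m = d.+1 by rewrite /d; lia.
have d0 : (0 < d)%N by lia.
have top j : (m < j)%N -> u`_j = 0.
  by move=> mj; apply: nth_default; exact: leq_trans um mj.
have topi i : (d < i)%N -> u`_m`_i = 0.
  by move=> di; apply: nth_default; rewrite sd.
have nz : u`_m`_d != 0.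
  by rewrite /d -/(lead_coef _) lead_coef_eq0 -size_poly_eq0 sd.
suff : hessian_kernel R d m d m != 0.
  move/eqP; apply; apply: (hessian_isolated_pair uc) => //.
    rewrite xpair_eqE; move: su; rewrite sd; case: (m =P 1%N) => /= ? ?; lia.
  move=> i j k l ei ej; rewrite xpair_eqE negb_and => ne nij nkl.
  have jm : (j <= m)%N.
    by rewrite leqNgt; apply: contra_neqN nij => /top ->; rewrite coef0.
  have lm : (l <= m)%N.
    by rewrite leqNgt; apply: contra_neqN nkl => /top ->; rewrite coef0.
  have jE : j = m by lia.
  have lE : l = m by lia.
  rewrite jE in nij; rewrite lE in nkl.
  have id : (i <= d)%N by rewrite leqNgt; apply: contra_neqN nij => /topi ->.
  have kd : (k <= d)%N by rewrite leqNgt; apply: contra_neqN nkl => /topi ->.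
  by move: ne; rewrite jE eqxx orbF; lia.
have -> : hessian_kernel R d m d m = - (d * m * (d + m - 1))%:R.
  rewrite !natrM natrB ?natrD /hessian_kernel; last by lia.
  ring.
by rewrite oppr_eq0 pnatr_eq0 !muln_eq0; lia.
Qed.

(* If [x^i y^j] had weight [k * i + j] above [m] with [j] maximal, then it would
   contribute to the coefficient of [x^i y^(m+j)] only together with [y^m]. *)
Lemma hessian_weight u (c : R) (k m : nat) :
    hessian u = c%:P%:P -> (0 < k)%N -> (1 < m)%N -> (k == 1%N) || (2 < m)%N ->
    (size u <= m.+1)%N -> u`_m != 0 ->
    (forall s, (s < k)%N -> (s <= m)%N -> size (u`_(m - s))%R <= 1)%N ->
  forall i j, u`_j`_i != 0 -> (k * i + j <= m)%N.
Proof.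
move=> uc k0 m1 km um nz low.
have top j : (m < j)%N -> u`_j = 0.
  by move=> mj; apply: nth_default; exact: leq_trans um mj.
have s0 : (size (u`_m)%R <= 1)%N by have := low 0%N; rewrite subn0; apply; lia.
have um0 : u`_m`_0 != 0.
  by apply: contra_neq nz => z; rewrite (size1_polyC s0) z.
have topi i : u`_m`_i != 0 -> i = 0%N.
  by case: i => // i; rewrite nth_default ?eqxx //; exact: leq_trans s0 _.
(* Induction downwards in [j], by its distance to the top degree [m]. *)
suff H s : forall i j, (m - j <= s)%N -> u`_j`_i != 0 -> (k * i + j <= m)%N.
  by move=> i j; apply: (H m); lia.
have jm i j : u`_j`_i != 0 -> (j <= m)%N.
  by move=> nij; rewrite leqNgt; apply: contra_neqN nij => /top ->; rewrite coef0.
elim: s => [|s IH] i j js nij.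
  have jE : j = m by have := jm _ _ nij; lia.
  by move: nij; rewrite jE => /topi ->; lia.
have [/IH|sj] := leqP (m - j) s; first by apply.
have jlt : (j < m)%N by lia.
rewrite leqNgt; apply/negP => bad.
(* For [i = 0] the weight is [j <= m]; for [i = 1], [bad] forces [m - j < k], where [low] makes the
   coefficient constant in x. *)
have i1 : (1 < i)%N.
  case: i nij bad => [|[|i]] // nij bad; first by lia.
  exfalso; move: nij; have -> : j = (m - (m - j))%N by lia.
  rewrite nth_default ?eqxx //; apply: low; lia.
suff : hessian_kernel R i j 0 m != 0.
  move/eqP; apply; apply: (hessian_isolated_pair uc) => //.
    rewrite xpair_eqE; apply/negP => /andP [/eqP e1 /eqP e2].
    by move: km bad; case: eqP => [->|_] /=; nia.
  move=> a b a' b' ea eb ne nab nab'.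
  have bm := jm _ _ nab; have bm' := jm _ _ nab'.
  have [ej|nj] := eqVneq b j.
    have eb' : b' = m by lia.
    move: nab'; rewrite eb' => /topi a'0.
    by move: ne; rewrite xpair_eqE ej eqxx andbT; lia.
  (* The same pair in reverse order: the kernel is not symmetric and vanishes when y^m comes
     first. *)
  have [ej|nj'] := eqVneq b' j.
    have eb' : b = m by lia.
    move: nab; rewrite eb' => /topi ->.
    by rewrite /hessian_kernel; ring.
  (* Now [b] and [b'] both exceed [j], so both weights are at most [m] by induction; their sum gives
     [k * i + m + j <= 2 * m], against [bad]. *)
  have w1 := IH _ _ (_ : (m - b <= s)%N) nab.
  have w2 := IH _ _ (_ : (m - b' <= s)%N) nab'.
  exfalso; have := w1; have := w2; have : (k * i = k * a + k * a')%N by nia.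
  by lia.
have -> : hessian_kernel R i j 0 m = (i * (i - 1) * (m * (m - 1)))%:R.
  rewrite !natrM !natrB /hessian_kernel; try lia.
  ring.
by rewrite pnatr_eq0 !muln_eq0; lia.
Qed.

Lemma hessian_total_degree u (c : R) m :
    hessian u = c%:P%:P -> size u = m.+3 ->
  [/\ (size (u`_m.+2)%R <= 1)%N, u`_m.+2`_0 != 0
    & forall i j, u`_j`_i != 0 -> (i + j <= m.+2)%N].
Proof.
move=> uc um.
have top1 : (size (u`_m.+2)%R <= 1)%N.
  by apply: (hessian_top_coef uc) => //; rewrite um.
have nz : u`_m.+2 != 0.
  rewrite -[m.+2]/(m.+3.-1) -um -/(lead_coef u).
  by rewrite lead_coef_eq0 -size_poly_eq0 um.
split=> // [|i j nij].
  by apply: contra_neq nz => z; rewrite (size1_polyC top1) z.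
rewrite -(mul1n i); apply: (hessian_weight uc) nij => //; first by rewrite um.
by case => // _ _; rewrite subn0.
Qed.

End ConstantHessian.

(** * From a constant Hessian to a quadratic plus a polynomial in one linear form *)

(** Models the gradient of a quadratic plus G(a x + b y), with [f] as G'; the triples hold the
    coefficients of 1, x, y in the affine parts. *)
Definition ridge_gradient (R : comNzRingType) (u : {poly {poly R}}) : Prop :=
  exists (a b : R) (f : {poly R}) (p q : R * R * R), forall x y : R,
    (dx u).[y%:P].[x] = p.1.1 + p.1.2 * x + p.2 * y + a * f.[a * x + b * y] /\
    u^`().[y%:P].[x] = q.1.1 + q.1.2 * x + q.2 * y + b * f.[a * x + b * y].

Section RidgeGradient.
Variable R : numFieldType.
Implicit Types u : {poly {poly R}}.

Lemma ridge_gradient_swapXY u : ridge_gradient (swapXY u) -> ridge_gradient u.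
Proof.
case=> a [b [f [[[p0 p1] p2] [[[q0 q1] q2] H]]]].
exists b, a, f, (q0, q2, q1), (p0, p2, p1) => x y /=.
have [] := H y x; rewrite dx_swapXY deriv_swapXY !horner2_swapXY /= => -> ->.
by rewrite [b * x + _]addrC; split; ring.
Qed.

Lemma shearK (l : R) u : shear (- l) (shear l u) = u.
Proof.
rewrite /shear -comp_polyA comp_polyD comp_polyX comp_polyC scaleNr rmorphN.
by rewrite subrK comp_polyXr.
Qed.

Lemma ridge_gradient_shear (l : R) u :
  ridge_gradient u -> ridge_gradient (shear l u).
Proof.
case=> a [b [f [[[p0 p1] p2] [[[q0 q1] q2] H]]]].
exists (a + l * b), b, f.
exists (p0 + l * q0, p1 + l * p2 + l * (q1 + l * q2), p2 + l * q2).
exists (q0, q1 + l * q2, q2) => x y /=.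
have [/= Hx Hy] := H x (y + l * x).
rewrite dx_shear deriv_shear hornerD hornerM hornerC hornerD hornerM hornerC.
rewrite !horner_shear Hx Hy.
have -> : (a + l * b) * x + b * y = a * x + b * (y + l * x) by ring.
by split; ring.
Qed.

(** Such a [u] is p(x) + (q + r x) y + s y^2, so the linear form is x and [f] is p'. *)
Lemma ridge_gradient_low_degree u :
    (size u <= 3)%N -> (size (u`_2)%R <= 1)%N -> (size (u`_1)%R <= 2)%N ->
  ridge_gradient u.
Proof.
move=> u3 u2 u1.
have E1 : u`_1 = (u`_1`_0)%:P + (u`_1`_1)%:P * 'X.
  apply/polyP => -[|[|i]];
    rewrite coefD coefC coefCM coefX ?mulr0 ?mulr1 ?addr0 ?add0r //=.
  by rewrite nth_default //; apply: leq_trans u1 _.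
have Eu : u = (u`_0)%:P + (u`_1)%:P * 'X + (u`_2)%:P * 'X^2.
  apply/polyP => -[|[|[|i]]];
    rewrite !coefD coefC !coefCM coefX coefXn ?mulr0 ?mulr1 ?addr0 ?add0r //=.
  by rewrite nth_default //; apply: leq_trans u3 _.
exists 1, 0, (u`_0)^`().
exists (0, 0, u`_1`_1), (u`_1`_0, u`_1`_1, u`_2`_0 *+ 2) => x y /=.
rewrite E1 (size1_polyC u2) in Eu.
move: (u`_0) (u`_1`_0) (u`_1`_1) (u`_2`_0) Eu => p q r s -> {u u3 u2 u1 E1}.
split.
  rewrite expr2 !dxD !dxM !dxC dxX !derivD derivM !derivC derivX !hornerE.
  by rewrite /=; ring.
rewrite expr2 !derivD !derivM !derivC !derivX.
by rewrite !hornerE /=; ring.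
Qed.

Lemma ridge_gradient_deg_le1 u (c : R) :
  hessian u = c%:P%:P -> (size u <= 2)%N -> ridge_gradient u.
Proof.
move=> uc u2; apply: ridge_gradient_low_degree; first exact: leq_trans u2 _.
  by rewrite nth_default ?size_poly0.
exact: (hessian_top_coef uc).
Qed.

Lemma shear_top u (m : nat) (l : R) : size u = m.+2 ->
  [/\ (size (shear l u) <= m.+2)%N, (shear l u)`_m.+1 = u`_m.+1
    & (shear l u)`_m = u`_m + u`_m.+1 * (l *: 'X) *+ m.+1].
Proof.
move=> um.
have Z j : (\sum_(i < j) u`_i * ((l *: 'X) ^+ (i - j) *+ 'C(i, j))) = 0.
  by apply: big1 => i _; rewrite bin_small // mulr0n mulr0.
split.
- apply/leq_sizeP => j mj; rewrite coef_shear um; apply: big1 => i _.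
  by rewrite bin_small ?mulr0n ?mulr0 //; apply: leq_trans mj.
- by rewrite coef_shear um big_ord_recr /= Z subnn expr0 binn add0r mulr1.
- rewrite coef_shear um !big_ord_recr /= Z subnn expr0 binn add0r mulr1.
  by rewrite subSnn expr1 binSn mulrnAr.
Qed.

Lemma constant_hessian_ridge_gradient u (c : R) :
  hessian u = c%:P%:P -> ridge_gradient u.
Proof.
move=> uc; have [u2|] := leqP (size u) 2; first exact: ridge_gradient_deg_le1 uc u2.
case um : (size u) => [|[|[|m]]] // _.
have [top1 top0 W] := hessian_total_degree uc um.
have next2 : (size (u`_m.+1)%R <= 2)%N.
  apply/leq_sizeP => i i2; apply/eqP; apply/negPn/negP => /W; lia.
case: m um top1 top0 W next2 => [|m] um top1 top0 W next2.
  by apply: ridge_gradient_low_degree; rewrite ?um.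
(* The shear adds (m+3) l x times the constant top coefficient to the coefficient of y^(m+2), which
   has degree at most 1; this [l] cancels its x term. *)
pose l := - u`_m.+2`_1 / (u`_m.+3`_0 * m.+3%:R).
rewrite -[u](shearK l); apply: ridge_gradient_shear.
have [vs vtop vnext] := shear_top l um.
have vc : hessian (shear l u) = c%:P%:P by rewrite hessian_shear uc /shear comp_polyC.
set v := shear l u in vs vtop vnext vc *.
have vnext1 : (size (v`_m.+2)%R <= 1)%N.
  apply/leq_sizeP => i i1; rewrite vnext coefD coefMn (size1_polyC top1).
  rewrite coefCM coefZ coefX.
  case: i i1 => [|[|i]] // _; last first.
    by rewrite !mulr0 mul0rn addr0 nth_default //; exact: leq_trans next2 _.
  have N0 : m.+3%:R != 0 :> R by rewrite pnatr_eq0.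
  rewrite eqxx mulr1 -[_ *+ m.+3]mulr_natr /l; move: (m.+3%:R) N0 => N N0; field.
  by rewrite top0 N0.
(* Weight 2 on x is available: the two top coefficients are constant and the degree in y is at least
   3. *)
have W2 : forall i j, v`_j`_i != 0 -> (2 * i + j <= m.+3)%N.
  move=> i j; apply: (hessian_weight vc) => //.
    by rewrite vtop; apply: contra_neq top0 => ->; rewrite coef0.
  by case=> [|[|s]] // _ _; rewrite ?subn0 ?vtop // subSS subn0.
apply: ridge_gradient_swapXY.
have wc : hessian (swapXY v) = c%:P%:P.
  by rewrite hessian_swapXY vc swapXY_polyC map_polyC.
have [w2|] := leqP (size (swapXY v)) 2; first exact: ridge_gradient_deg_le1 wc w2.
case wn : (size (swapXY v)) => [|[|[|n]]] // _.
have [_ wtop0 W3] := hessian_total_degree wc wn.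
have mn : (m.+3 + 0 <= n.+2)%N by apply: W3; rewrite coef_swapXY vtop.
have nm : (2 * n.+2 + 0 <= m.+3)%N by apply: W2; rewrite -coef_swapXY.
lia.
Qed.

End RidgeGradient.

(** * Bounded polynomials; eigenvalue bounds on trace and determinant *)

(** Otherwise, up to sign, [p - M] has a positive leading coefficient and stays above it far out,
    against the bound. *)
Lemma bounded_poly_const (R : realFieldType) (p : {poly R}) (M : R) :
  (forall x, `|p.[x]| <= M) -> p = (p`_0)%:P.
Proof.
move=> pM; apply: size1_polyC; rewrite leqNgt; apply/negP => p1.
wlog p_gt0 : p pM p1 / 0 < lead_coef p => [W|].
  case: (ltgtP (lead_coef p) 0) => [pn|pp|p0].
  - apply: (W (- p)).
    + by move=> x; rewrite hornerN normrN.
    + by rewrite size_polyN.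
    + by rewrite lead_coefN oppr_gt0.
  - exact: W.
  - by move/eqP: p0; rewrite lead_coef_eq0 => /eqP p0; rewrite p0 size_poly0 in p1.
have lE : lead_coef (p - M%:P) = lead_coef p.
  by rewrite lead_coefDl // size_polyN (leq_ltn_trans (size_polyC_leq1 _)).
have [|n nP] := @polyrcf.poly_pinfty_gt_lc _ (p - M%:P); first by rewrite lE.
have := nP n (lexx _); rewrite lE !hornerE => h.
have := le_trans (ler_norm _) (pM n); lra.
Qed.

Lemma bounded_bipoly_const (R : realFieldType) (u : {poly {poly R}}) (M : R) :
  (forall x y, `|u.[y%:P].[x]| <= M) -> exists c : R, u = c%:P%:P.
Proof.
move=> uM.
have u1 : u = (u`_0)%:P.
  apply/size1_polyC/leq_sizeP => j j1.
  (* For fixed [x] the polynomial in y is bounded, hence constant, so its higher coefficients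
     vanish. *)
  have Z x : (u`_j).[x] = 0.
    have := @bounded_poly_const _ (map_poly (horner_eval x) u) M.
    move=> /(_ _)/(congr1 (fun p : {poly R} => p`_j)).
    rewrite coefC coef_map /= /horner_eval => ->.
      by case: j j1.
    by move=> y; have := uM x y; rewrite -horner2_swapXY horner_swapXY.
  have -> := @bounded_poly_const _ (u`_j) 0; last by move=> x; rewrite Z normr0.
  by rewrite -horner_coef0 Z.
exists u`_0`_0; rewrite {1}u1; congr polyC.
by apply: (@bounded_poly_const _ _ M) => x; have := uM x 0; rewrite u1 hornerC coefC.
Qed.

(** Over [R[i]] the characteristic polynomial splits as (X - a)(X - b) with eigenvalues a, b; the
    trace is a + b and the determinant a b. *)
Lemma complex_eigenvalue_lt1_bounds (R : realType) (A : 'M[R]_2) :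
    (forall z, complex_eigenvalue A z -> `|z| < 1) ->
  `|\tr A| <= 2 /\ `|\det A| <= 1.
Proof.
move=> Az; set M := map_mx (real_complex R) A.
have [rs] := closed_field_poly_normal (char_poly M).
rewrite (monicP (char_poly_monic M)) scale1r => E.
have := congr1 (fun p : {poly R[i]} => size p) E.
rewrite size_char_poly size_prod_XsubC.
case: rs E => [|a [|b [|]]] // E _; rewrite !big_cons big_nil mulr1 in E.
have ev z : root (char_poly M) z -> `|z| <= 1.
  by rewrite -eigenvalue_root_char => /Az/ltW.
have a1 : `|a| <= 1 by apply: ev; rewrite E rootM root_XsubC eqxx.
have b1 : `|b| <= 1 by apply: ev; rewrite E rootM !root_XsubC eqxx orbT.
have E2 : ('X - a%:P) * ('X - b%:P) = 'X^2 - (a + b)%:P * 'X + (a * b)%:P.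
  by rewrite rmorphD rmorphM /=; ring.
have := char_poly_trace M isT; rewrite /= E E2 !coefE /= => trE.
have := char_poly_det M; rewrite /= E E2 !coefE /= => detE.
have nR (x : R) (y : R) : `|x%:C%C| <= y%:C%C -> `|x| <= y.
  by rewrite normc_def /= expr0n addr0 sqrtr_sqr lecR.
split; apply: nR.
  rewrite -trace_map_mx -/M -[X in `|X|]opprK -trE.
  have -> : - (0 - (a + b) * 1 + 0) = a + b by ring.
  by apply: le_trans (ler_normD _ _) _; rewrite rmorphD rmorph1 lerD.
rewrite -det_map_mx -/M.
rewrite mulr0 subr0 add0r sqrrN expr1n mul1r in detE.
by rewrite -detE normrM rmorph1 mulr_ile1.
Qed.

(** * Jacobian entries as formal partial derivatives *)

Section Jacobian.
Variable R : realType.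
Implicit Type u : {poly {poly R}}.

Lemma vec2D_e0 (x y h : R) : h *: delta_mx 0 0 + vec2 x y = vec2 (h + x) y.
Proof.
apply/matrixP => i j; rewrite !mxE (ord1 j) eqxx andbT.
by case: i => [[|[|]]] //= ?; rewrite ?mulr1 // mulr0 add0r.
Qed.

Lemma vec2D_e1 (x y h : R) : h *: delta_mx 1 0 + vec2 x y = vec2 x (h + y).
Proof.
apply/matrixP => i j; rewrite !mxE (ord1 j) eqxx andbT.
by case: i => [[|[|]]] //= ?; rewrite ?mulr1 // mulr0 add0r.
Qed.

(** Along a coordinate axis the difference quotient of [f] is the same function of the increment as
    that of a one-variable polynomial, so the limits agree. *)
Lemma derive_vec2_x u (f : 'cV[R]_2 -> R) (x y : R) :
    (forall x y, f (vec2 x y) = u.[y%:P].[x]) ->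
  'D_(delta_mx 0 0) f (vec2 x y) = (dx u).[y%:P].[x].
Proof.
move=> fu; rewrite /dx horner_swapXY -deriv_map -horner_polyC derivE derive1E.
rewrite /derive; set g1 := fun h => h^-1 *: _; set g2 := fun h => h^-1 *: _.
suff -> : g1 = g2 by []; apply/funext => h; rewrite /g1 /g2 /=.
by rewrite vec2D_e0 !fu [h *: 1]mulr1.
Qed.

Lemma derive_vec2_y u (f : 'cV[R]_2 -> R) (x y : R) :
    (forall x y, f (vec2 x y) = u.[y%:P].[x]) ->
  'D_(delta_mx 1 0) f (vec2 x y) = u^`().[y%:P].[x].
Proof.
move=> fu; rewrite -horner2_swapXY horner_swapXY -deriv_map derivE derive1E.
rewrite /derive; set g1 := fun h => h^-1 *: _; set g2 := fun h => h^-1 *: _.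
suff -> : g1 = g2 by []; apply/funext => h; rewrite /g1 /g2 /=.
by rewrite vec2D_e1 !fu [h *: 1]mulr1 -!horner_swapXY !horner2_swapXY.
Qed.

End Jacobian.

(** * Integration of the trace-free part, and conclusion *)

Lemma det_2x2 (R : comNzRingType) (A : 'M[R]_2) :
  \det A = A 0 0 * A 1 1 - A 0 1 * A 1 0.
Proof.
rewrite (expand_det_row _ 0) big_ord_recl big_ord1 /cofactor !det_mx11 !mxE /=.
have -> : lift 0 0 = 1 :> 'I_2 by apply/val_inj.
have -> : lift 1 0 = 0 :> 'I_2 by apply/val_inj.
by rewrite /bump /= expr0 expr1; ring.
Qed.

Lemma mxtrace_2x2 (R : comNzRingType) (A : 'M[R]_2) : \tr A = A 0 0 + A 1 1.
Proof.
rewrite /mxtrace big_ord_recl big_ord1.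
by have -> : lift ord0 ord0 = 1 :> 'I_2 by apply/val_inj.
Qed.

(** Polynomial Poincare lemma: integrate [p] in y, then add the integral in x of the part of [q]
    free of y. *)
Lemma potential_exists (R : numFieldType) (p q : {poly {poly R}}) :
  dx p = q^`() -> exists u : {poly {poly R}}, dx u = q /\ u^`() = p.
Proof.
move=> pq.
(* At [i = 0] the division by zero yields 0, so [r] has no constant term. *)
pose r := \poly_(i < (size q`_0).+1) (q`_0`_i.-1 / i%:R).
pose u := \poly_(j < (size p).+1) (if j is k.+1 then k.+1%:R^-1 *: p`_k else r).
have u0 : u`_0 = r by rewrite coef_poly.
have uS k : u`_k.+1 = k.+1%:R^-1 *: p`_k.
  rewrite coef_poly ltnS; case: ltnP => // h.
  by rewrite nth_default // scaler0.
have rS i : r`_i.+1 = q`_0`_i / i.+1%:R.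
  by rewrite coef_poly ltnS; case: ltnP => // h; rewrite nth_default // mul0r.
have divK n (z : R) : n.+1%:R^-1 * z *+ n.+1 = z.
  by rewrite -mulrnAr -[z *+ _]mulr_natl mulKf // pnatr_eq0.
exists u; split; apply/polyP => j; apply/polyP => i.
  rewrite coef_dx; case: j => [|k]; first by rewrite u0 rS mulrC divK.
  have := congr1 (fun v : {poly {poly R}} => v`_k`_i) pq.
  rewrite /= coef_dx coef_deriv coefMn uS coefZ -mulrnAr => ->.
  by rewrite mulrnAr divK.
by rewrite coef_deriv uS coefMn coefZ divK.
Qed.

(** Separates the affine part of the ridge function, whose linear term goes into the matrix B, from
    the part divisible by u^2. *)
Lemma horner_split2 (R : comNzRingType) (f : {poly R}) :
  exists (c0 c1 : R) (g : {poly R}), forall u, f.[u] = c0 + c1 * u + u ^+ 2 * g.[u].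
Proof.
exists f`_0, f`_1, (drop_poly 2 f) => u.
rewrite -{1}(poly_take_drop 2 f) hornerD hornerM hornerXn mulrC; congr (_ + _).
by rewrite horner_poly !big_ord_recr big_ord0 /= add0r expr0 expr1 mulr1.
Qed.

Theorem theorem2p1 (R : realType) (F : 'cV[R]_2 -> 'cV[R]_2)
    (F_poly : polynomial_map F) (F0 : F 0 = 0)
    (F_eig : forall (x y : R) (z : R[i]),
       complex_eigenvalue (jacobian_mx F (vec2 x y)) z -> `|z| < 1) :
  exists (B : 'M[R]_2) (alpha beta a b : R) (p : {poly R}),
    forall x y : R,
      let u := a * x + b * y in
      F (vec2 x y) = B *m vec2 x y + (u ^+ 2 * p.[u]) *: vec2 alpha beta.
Proof.
have [P HP] := F_poly 0; have [Q HQ] := F_poly 1.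
have J00 x y : jacobian_mx F (vec2 x y) 0 0 = (dx P).[y%:P].[x].
  by rewrite mxE; apply: derive_vec2_x.
have J01 x y : jacobian_mx F (vec2 x y) 0 1 = P^`().[y%:P].[x].
  by rewrite mxE; apply: derive_vec2_y.
have J10 x y : jacobian_mx F (vec2 x y) 1 0 = (dx Q).[y%:P].[x].
  by rewrite mxE; apply: derive_vec2_x.
have J11 x y : jacobian_mx F (vec2 x y) 1 1 = Q^`().[y%:P].[x].
  by rewrite mxE; apply: derive_vec2_y.
have [t tE] : exists t : R, dx P + Q^`() = t%:P%:P.
  apply: (@bounded_bipoly_const _ _ 2) => x y; rewrite !hornerD -J00 -J11 -mxtrace_2x2.
  by case: (complex_eigenvalue_lt1_bounds (F_eig x y)).
have [d dE] : exists d : R, dx P * Q^`() - P^`() * dx Q = d%:P%:P.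
  apply: (@bounded_bipoly_const _ _ 1) => x y.
  rewrite !(hornerD, hornerN, hornerM) -J00 -J11 -J01 -J10 -det_2x2.
  by case: (complex_eigenvalue_lt1_bounds (F_eig x y)).
pose s := t / 2; pose sp : {poly {poly R}} := s%:P%:P.
have sE : t%:P%:P = sp + sp :> {poly {poly R}}.
  by rewrite -!rmorphD /s; congr (_%:P%:P); field.
have QE : Q^`() = sp + sp - dx P by rewrite -sE -tE addrC addKr.
(* The field (P - s x, Q - s y) has zero divergence, so it is (u_y, -u_x). *)
have [|u [ux uy]] := @potential_exists _ (P - sp * 'X%:P) (sp * 'X - Q).
  rewrite dxD dxN dxM !dxC derivX derivB derivM derivX !derivC QE.
  by ring.
have uH : hessian u = (d - s ^+ 2)%:P%:P.
  rewrite /hessian ux uy !rmorphB /= -dE QE !(dxD, dxN, dxM, dxC, dxX).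
  rewrite !(derivD, derivN, derivM, derivC, derivX).
  by rewrite !rmorphXn /= -/sp; ring.
have [a [b [f [[[p0 p1] p2] [[[q0 q1] q2] H]]]]] := constant_hessian_ridge_gradient uH.
have [f0 [f1 [g fE]]] := horner_split2 f.
(* The matrix gathers s times the identity, the linear parts of (u_y, -u_x) and the [f1] term; that
   same rotated gradient turns the ridge direction (a, b) into (b, -a). *)
exists (\matrix_(i, j) (nth [::] [:: [:: s + q1 + b * f1 * a; q2 + b * f1 * b];
                        [:: - p1 - a * f1 * a; s - p2 - a * f1 * b]] i)`_j).
exists b, (- a), a, b, g => x y v.
have v0 : vec2 0 0 = 0 :> 'cV[R]_2.
  by apply/matrixP => i j; rewrite !mxE; case: i => [[|[|]]].
have PE x1 y1 := proj2 (H x1 y1); have QQE x1 y1 := proj1 (H x1 y1).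
(* At the origin [F0] forces the constant terms to cancel: q0 + b f0 = 0 and p0 + a f0 = 0. *)
have z0 := PE 0 0; have z1 := QQE 0 0.
have := HP 0 0; have := HQ 0 0; rewrite v0 F0 !mxE => Q0 P0.
have P1 := PE x y; have Q1 := QQE x y.
rewrite uy !fE !(hornerD, hornerN, hornerM, hornerC, hornerX) -/v -HP in P1.
rewrite uy !fE !(hornerD, hornerN, hornerM, hornerC, hornerX) -P0 in z0.
rewrite ux !fE !(hornerD, hornerN, hornerM, hornerC, hornerX) -/v -HQ in Q1.
rewrite ux !fE !(hornerD, hornerN, hornerM, hornerC, hornerX) -Q0 in z1.
rewrite /= !(mulr0, add0r, addr0, expr0n, mul0r, subr0) in z0 z1.
have q0E : q0 = - (b * f0) by apply/eqP; rewrite -addr_eq0 -z0 oppr0.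
have p0E : p0 = - (a * f0) by apply/eqP; rewrite -addr_eq0 -z1 oppr0.
have {P1} P1 : F (vec2 x y) 0 0 = s * x + (q0 + q1 * x + q2 * y +
    b * (f0 + f1 * v + v ^+ 2 * g.[v])) by rewrite -P1; ring.
have {Q1} Q1 : F (vec2 x y) 1 0 = s * y - (p0 + p1 * x + p2 * y +
    a * (f0 + f1 * v + v ^+ 2 * g.[v])) by rewrite -Q1; ring.
apply/matrixP => i j; rewrite (ord1 j) !mxE !big_ord_recl big_ord0 !mxE /=.
case: i => [[|[|]]] //= hi.
  have -> : Ordinal hi = 0 by apply/val_inj.
  by rewrite P1 q0E /v; ring.
have -> : Ordinal hi = 1 by apply/val_inj.
by rewrite Q1 p0E /v; ring.
Qed.
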